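(* Let $(p^+_{n,b})_{n\ge0}$ be the steady-state probabilities that, at a service completion epoch, the departing batch has size $b$ and $n$ customers are in the queue, in the queueing system described in the context. Suppose that the service and vacation time distributions are such that $\sum_{n=0}^\infty p^+_{n,b}x^n=\Lambda(x)/D(x)$ with polynomials $\Lambda$ of degree $L_1$ and $D$ of degree $M_1$, where $D$ has exactly $b$ zeros in $|x|\le1$, all simple, and its remaining $M_1-b$ zeros $\alpha_1,\dots,\alpha_{M_1-b}$ lie in $|x|>1$ and are distinct (simple). Put $$c_k=-\frac{\Lambda(\alpha_k)}{D'(\alpha_k)},\qquad k=1,\dots,M_1-b.$$ (1) If $L_1\ge M_1$ and $\sum_{i=0}^{L_1-M_1}\tau_ix^i$ is the quotient of the polynomial division of $\Lambda$ by $D$, then $$p^+_{n,b}=\begin{cases}\tau_n+\sum_{k=1}^{M_1-b}\dfrac{c_k}{\alpha_k^{n+1}},&0\le n\le L_1-M_1,\\[2mm]\sum_{k=1}^{M_1-b}\dfrac{c_k}{\alpha_k^{n+1}},&n>L_1-M_1.\end{cases}$$ (2) If $L_1<M_1$, then $p^+_{n,b}=\sum_{k=1}^{M_1-b}\dfrac{c_k}{\alpha_k^{n+1}}$ for all $n\ge0$.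
   Context: The system is a discrete-time single-server queue with Bernoulli($\lambda$) arrivals, $0<\lambda<1$. Customers are served in batches by the $(a,b)$ rule ($1\le a\le b$): service starts only if at least $a$ customers wait; all are taken if there are between $a$ and $b$, otherwise exactly $b$. The service time of a batch of size $r$ has a general distribution on $\{1,2,\dots\}$ depending on $r$, with pgf $S^*_r$ and finite mean $1/\mu_r$. After a service, if fewer than $a$ wait, the server takes a vacation of general distribution on $\{1,2,\dots\}$ with pgf $V^*$; if fewer than $a$ wait at the end of a vacation, the server either stays dormant until $a$ have accumulated (single vacation) or takes another vacation (multiple vacation). Stability $\lambda/(b\mu_b)<1$ is assumed. The numbers $p^+_{n,r}$ ($n\ge0$, $a\le r\le b$) are the steady-state probabilities that, at an epoch which is either a service completion or a vacation termination, a service of a batch of size $r$ is completed and $n$ customers are left in the queue; in particular $p^+_{n,b}\ge0$ and $\sum_{n\ge0}p^+_{n,b}\le1$. The denominator $D(x)$ arises from $x^b-K^{(b)}(x)$, with $K^{(b)}(x)=S^*_b(1-\lambda+\lambda x)$, after clearing denominators. *)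

(* Defs.v *)
From HB Require Import structures.
From mathcomp Require Import all_boot all_order all_algebra.
From mathcomp Require Import complex.
From mathcomp Require Import all_classical all_reals all_analysis.

Set Implicit Arguments.
Unset Strict Implicit.
Unset Printing Implicit Defensive.

Import Order.TTheory GRing.Theory Num.Theory.
Import numFieldNormedType.Exports.

Local Open Scope classical_set_scope.
Local Open Scope ring_scope.
Local Open Scope complex_scope.

(* Probability mass functions on {1, 2, ...}, as functions on nat. *)
Definition is_duration {R : realType} (f : nat -> R) : Prop :=
  [/\ f 0%N = 0, forall j, 0 <= f j & series f @ \oo --> (1 : R)].

Inductive vacation_policy := SingleVacation | MultipleVacation.

(* Only the service laws [svc r] with a <= r <= b matter; [svc r j] is the
   probability that serving a batch of size r takes j slots. *)
Record bulk_queue (R : realType) := BulkQueue {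
  arr : R;
  minb : nat;
  maxb : nat;
  svc : nat -> nat -> R;
  rate : nat -> R;
  vac : nat -> R;
  policy : vacation_policy;
  arr_gt0 : 0 < arr;
  arr_lt1 : arr < 1;
  minb_gt0 : (0 < minb)%N;
  minb_le : (minb <= maxb)%N;
  svc_duration : forall r, (minb <= r <= maxb)%N -> is_duration (svc r);
  rate_gt0 : forall r, (minb <= r <= maxb)%N -> 0 < rate r;
  svc_mean : forall r, (minb <= r <= maxb)%N ->
    series (fun j => j%:R * svc r j) @ \oo --> (rate r)^-1;
  vac_duration : is_duration vac;
  stable : arr / (maxb%:R * rate maxb) < 1
}.

(* State seen just after an epoch which is a service completion or a vacation
   termination: [(n, Some r)] if a batch of size r has been served, [(n, None)]
   if a vacation has ended; n customers are left in the queue. *)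
Definition epoch_state := (nat * option nat)%type.

Section EmbeddedChain.
Context {R : realType} (Q : bulk_queue R).

(* Probability of k arrivals during a random time of law T: given T = j, their
   number is binomial with parameters j and the arrival probability. *)
Definition arrivals (T : nat -> R) (k : nat) : R :=
  lim (series (fun j => T j * binomial_pmf j (arr Q) k) @ \oo).

(* Probability that the next epoch yields t when a service starts with n >= a
   customers waiting. *)
Definition after_service (n : nat) (t : epoch_state) : R :=
  let r := minn n (maxb Q) in
  if (t.2 == Some r) && (n - r <= t.1)%N
  then arrivals (svc Q r) (t.1 - (n - r)) else 0.

Definition after_vacation (n : nat) (t : epoch_state) : R :=
  if (t.2 == None) && (n <= t.1)%N then arrivals (vac Q) (t.1 - n) else 0.

(* Arrivals being single, a dormant server starts its next service with exactly
   a customers waiting; dormancy creates no epoch of its own. *)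
Definition transition (s t : epoch_state) : R :=
  if (minb Q <= s.1)%N then after_service s.1 t
  else match s.2, policy Q with
       | None, SingleVacation => after_service (minb Q) t
       | _, _ => after_vacation s.1 t
       end.

Definition steady_state (pi : epoch_state -> R) : Prop :=
  [/\ forall s, 0 <= pi s,
      (\esum_(s in [set: epoch_state]) (pi s)%:E = 1)%E
    & forall t, ((pi t)%:E =
        \esum_(s in [set: epoch_state]) (pi s * transition s t)%:E)%E].

End EmbeddedChain.

(* [R[i]^o] is [R[i]] with the topology given by the modulus. *)
Definition gf_term {R : realType} (f : nat -> R) (x : R[i]) : nat -> R[i]^o :=
  fun n => (f n)%:C * x ^+ n.

Definition pgf {R : realType} (f : nat -> R) (x : R[i]) : R[i]^o :=
  lim (series (gf_term f x) @ \oo).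

(* K^(b)(x) = S_b^*(1 - lambda + lambda x) *)
Definition Kb {R : realType} (Q : bulk_queue R) (x : R[i]) : R[i] :=
  pgf (svc Q (maxb Q)) (1 - (arr Q)%:C + (arr Q)%:C * x).

(* s lists, without repetition, the zeros of P in the region A, and these are
   all simple. *)
Definition simple_zeros {F : fieldType} (P : {poly F}) (A : pred F)
    (s : seq F) : Prop :=
  [/\ uniq s, forall x, (x \in s) = root P x && A x
    & forall x, x \in s -> mup x P = 1%N].

(* Main.v *)
Require Import Defs.
From HB Require Import structures.
From mathcomp Require Import all_boot all_order all_algebra.
From mathcomp Require Import complex.
From mathcomp Require Import all_classical all_reals all_analysis.
From mathcomp Require Import ring finmap.

(** Let [F] be the generating function of [p n]. Its coefficients are nonnegative
    with sum at most 1, so [|F| <= 1] on the closed unit disc and hence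
    [|Lambda| <= |D|] there; thus [Lambda] vanishes at the zeros of [D] in the
    disc. Only the zeros [a_k] outside survive in the partial fraction expansion
    of [Lambda / D], and each [1 / (a_k - x)] is a geometric series with ratio
    [x / a_k]. The claimed formula therefore has the same generating function as
    [p] near 0, away from the zeros of [D], and a power series with bounded
    coefficients that vanishes at points accumulating at 0 is identically 0. *)

Set Implicit Arguments.
Unset Strict Implicit.
Unset Printing Implicit Defensive.

Import Order.TTheory GRing.Theory Num.Theory.
Import numFieldNormedType.Exports.

Local Open Scope classical_set_scope.
Local Open Scope ring_scope.
Local Open Scope complex_scope.

(** * Polynomials on the closed unit disc *)

(** Factor [p - p.[y]%:P] as [g * ('X - y%:P)]; on the unit disc [g] is bounded by the sum of the
    moduli of its coefficients. *)
Lemma poly_lipschitz (K : numFieldType) (p : {poly K}) (y : K) :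
  exists2 B : K, 0 <= B &
    forall x, `|x| <= 1 -> `|p.[x] - p.[y]| <= B * `|x - y|.
Proof.
have /factor_theorem[g pE] : root (p - p.[y]%:P) y.
  by rewrite /root !hornerE subrr.
exists (\sum_(i < size g) `|g`_i|) => [|x x1]; first by rewrite sumr_ge0.
have -> : p.[x] - p.[y] = g.[x] * (x - y).
  by have := congr1 (fun q => q.[x]) pE; rewrite !hornerE.
rewrite normrM ler_wpM2r // horner_coef (le_trans (ler_norm_sum _ _ _)) //.
apply: ler_sum => i _; rewrite normrM normrX ler_piMr //.
by rewrite exprn_ile1.
Qed.

(** Since [y] may lie on the unit circle, it is approached along a segment inside the disc, which is
    convex. *)
Lemma nonroot_near (K : numFieldType) (p : {poly K}) (y e : K) :
  p != 0 -> `|y| <= 1 -> 0 < e ->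
  exists x, [/\ `|x| <= 1, 0 < `|x - y| < e & ~~ root p x].
Proof.
(* The other end of the segment: 0, or 1 when [y] is itself 0. *)
move=> p0 y1 e0; pose z : K := (y == 0)%:R.
have zy : z - y != 0.
  rewrite /z; case: (eqVneq y 0) => [->|y0]; first by rewrite subr0 oner_neq0.
  by rewrite sub0r oppr_eq0.
have z1 : `|z| <= 1 by rewrite /z; case: (y == 0); rewrite ?normr0 ?normr1.
have zy2 : `|z - y| <= 2.
  by rewrite (le_trans (ler_normB _ _)) // -[2]/(1 + 1) lerD.
(* [u <= 1] keeps the points on the segment; [2 * u < e] keeps them within [e] of [y], as [z] and
   [y] are at most 2 apart. *)
pose u : K := e / (2 + e).
have e2 : 0 < 2 + e by rewrite addr_gt0 // ltr0n.
have u0 : 0 < u by rewrite divr_gt0.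
have u1 : u <= 1 by rewrite ler_pdivrMr // mul1r lerDr ler0n.
have ue : 2 * u < e.
  rewrite /u mulrA ltr_pdivrMr // mulrDr [2 * e]mulrC ltrDl mulr_gt0 //.
(* [size p] distinct points on the segment from y to z; p has fewer roots. *)
pose t (j : nat) := u / j.+1%:R.
have t0 j : 0 < t j by rewrite divr_gt0 // ltr0n.
have tu j : t j <= u.
  by rewrite ler_pdivrMr ?ltr0n // ler_peMr ?ler1n // ltW.
pose X j := y + t j * (z - y).
have [[j Hj]|all_root] := pselect (exists j, ~~ root p (X j)).
  exists (X j); split => //.
    have -> : X j = (1 - t j) * y + t j * z by rewrite /X; ring.
    have t1 : 0 <= 1 - t j by rewrite subr_ge0 (le_trans (tu j)).
    rewrite (le_trans (ler_normD _ _)) // (normrM (1 - t j)) (normrM (t j)).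
    rewrite (ger0_norm t1) (gtr0_norm (t0 j)).
    rewrite (@le_trans _ _ ((1 - t j) * 1 + t j * 1)) ?lerD ?ler_wpM2l //.
      exact: ltW.
    by rewrite !mulr1 subrK.
  rewrite /X addrC addKr normr_gt0 mulf_neq0 ?(gt_eqF (t0 j)) //=.
  rewrite (normrM (t j)) (gtr0_norm (t0 j)) (le_lt_trans _ ue) // mulrC ler_pM //.
  exact: ltW.
have inj : injective X.
  move=> i j /addrI/(mulIf zy)/(mulfI (lt0r_neq0 u0))/invr_inj/eqP.
  by rewrite eqr_nat eqSS => /eqP.
have := @max_poly_roots _ p (map X (iota 0 (size p))) p0.
rewrite map_inj_uniq // iota_uniq size_map size_iota ltnn => H.
suff // : false by [].
apply: H => //; apply/allP => _ /mapP[j _ ->].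
by apply: contrapT => /negP ?; apply: all_root; exists j.
Qed.

(** * Identity theorem for power series *)

(** If [m] is the least index with [d m != 0], then close enough to 0 its term outweighs all later
    ones, so the partial sums stay away from 0. *)
Lemma bounded_coef_identity (K : numFieldType) (d : nat -> K) (C : K) :
  (forall n, `|d n| <= C) ->
  (forall e, 0 < e -> exists2 x, 0 < `|x| < e &
     forall h, 0 < h -> exists N, forall n, (N <= n)%N ->
       `|\sum_(i < n) d i * x ^+ i| < h) ->
  forall n, d n = 0.
Proof.
move=> dC H; elim/ltn_ind => m IH; apply/eqP/negP => /negP dm.
have C0 : 0 <= C by apply: le_trans (dC 0%N).
have D0 : 0 < `|d m| by rewrite normr_gt0.
(* If [`|x| < `|d m| / w], the term of index m dominates the tail, which is
   at most [2 * C * `|x| ^+ m.+1]. *)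
pose w := 2 * C + 2 * `|d m|.
have w0 : 0 < w by rewrite ltr_wpDl ?mulr_ge0 ?mulr_gt0 ?ler0n ?ltr0n.
have [x /andP[x0 xe] Hx] := H _ (divr_gt0 D0 w0).
have xw : `|x| * (2 * C) + `|x| * (2 * `|d m|) < `|d m|.
  by rewrite -mulrDr -ltr_pdivlMr.
have x2 : 2 * `|x| <= 1.
  rewrite -(ler_pM2r D0) mul1r -mulrA mulrCA ltW //; apply: le_lt_trans xw.
  by rewrite lerDr !mulr_ge0 ?ler0n.
(* The factor [2 * (1 - |x| ^+ l)] bounds the geometric sum of [l] terms because [2 * |x| <= 1];
   this form lets the induction on [l] go through. *)
have tail l : `|\sum_(i < m.+1 + l) d i * x ^+ i - d m * x ^+ m| <=
    C * `|x| ^+ m.+1 * (2 * (1 - `|x| ^+ l)).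
  elim: l => [|l IHl].
    rewrite addn0 big_ord_recr /= big1 ?add0r ?subrr ?normr0 ?expr0 ?subrr ?mulr0 //.
    by move=> i _; rewrite IH ?mul0r.
  rewrite addnS big_ord_recr /= addrAC (le_trans (ler_normD _ _)) //.
  have -> : C * `|x| ^+ m.+1 * (2 * (1 - `|x| ^+ l.+1)) =
     C * `|x| ^+ m.+1 * (2 * (1 - `|x| ^+ l)) +
     C * `|x| ^+ m.+1 * (2 * (`|x| ^+ l - `|x| ^+ l.+1)).
    by rewrite -!mulrDr addrA subrK.
  rewrite lerD // normrM normrX exprD mulrA.
  rewrite ler_pM ?mulr_ge0 ?exprn_ge0 // ?ler_wpM2r ?exprn_ge0 //.
  rewrite exprS (_ : 2 * _ = `|x| ^+ l + (1 - 2 * `|x|) * `|x| ^+ l); last first.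
    by ring.
  by rewrite lerDl mulr_ge0 ?exprn_ge0 // subr_ge0.
(* The threshold is the modulus of term [m] minus the tail bound, hence a lower bound for every
   partial sum that includes term [m]. *)
have [|N HN] := Hx ((`|d m| - `|x| * (2 * C)) * `|x| ^+ m).
  rewrite mulr_gt0 ?exprn_gt0 // subr_gt0 (le_lt_trans _ xw) // lerDl.
  by rewrite !mulr_ge0 ?ler0n.
have := HN (m.+1 + N)%N (leq_addl _ _); apply/negP.
rewrite -real_leNgt ?ger0_real //; last first.
  rewrite mulr_ge0 ?exprn_ge0 // subr_ge0 ltW // (le_lt_trans _ xw) // lerDl.
  by rewrite !mulr_ge0 ?ler0n.
rewrite mulrBl lerBlDr -normrX -normrM.
set S := \sum_(i < _) _.
rewrite -[d m * _](subKr S) (le_trans (ler_normB _ _)) // lerD2l.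
rewrite normrX (le_trans (tail N)) //.
rewrite (_ : _ * _ * _ = `|x| * (2 * C) * `|x| ^+ m * (1 - `|x| ^+ N)); last first.
  by rewrite exprS; ring.
by rewrite ler_piMr ?mulr_ge0 ?exprn_ge0 ?ler0n // gerBl exprn_ge0.
Qed.

(** * Simple zeros and partial fractions *)

Lemma mup1_deriv_neq0 (F : fieldType) (p : {poly F}) (a : F) :
  p != 0 -> mup a p = 1%N -> p^`().[a] != 0.
Proof.
move=> p0 pa.
have /dvdpP[q pE] : 'X - a%:P %| p by rewrite XsubC_dvd // pa.
have : ~~ (('X - a%:P) ^+ 2 %| p) by rewrite -mup_leq // pa.
rewrite pE derivM derivXsubC !hornerE subrr mulr0 add0r.
apply: contra => qa.
by rewrite exprS expr1 dvdp_mul // dvdp_XsubCl.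
Qed.

Lemma partial_fractions (F : fieldType) (p q : {poly F}) (s : seq F) :
  q != 0 -> (size q <= (size s).+1)%N -> (size p < size q)%N ->
  uniq s -> {in s, forall a, mup a q = 1%N} ->
  forall x, q.[x] != 0 ->
    p.[x] / q.[x] = \sum_(a <- s) p.[a] / q^`().[a] / (x - a).
Proof.
move=> q0 sq pq us qs x qx.
have qE a : a \in s -> q = q %/ ('X - a%:P) * ('X - a%:P).
  by move=> /qs qa; rewrite divpK // XsubC_dvd // qa.
pose f := \sum_(a <- s) (p.[a] / q^`().[a]) *: (q %/ ('X - a%:P)).
have pE : p = f.
  apply/eqP; rewrite -subr_eq0; apply/negP => /negP pf0.
  have: (size s < size (p - f)%R)%N.
    apply: max_poly_roots => //; apply/allP => b bs.
    rewrite /root !hornerE horner_sum (bigD1_seq b) //= big1_seq ?addr0.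
      have qb : q^`().[b] = (q %/ ('X - b%:P)).[b].
        by rewrite {1}(qE b) // derivM derivXsubC !hornerE subrr mulr0 add0r.
      by rewrite hornerZ -qb divfK ?subrr // mup1_deriv_neq0 ?qs.
    move=> a /andP[ab as_]; rewrite hornerZ.
    suff -> : (q %/ ('X - a%:P)).[b] = 0 by rewrite mulr0.
    have : q.[b] = 0.
      by rewrite (qE b) // !hornerE subrr mulr0.
    rewrite {1}(qE a) // !hornerE => /eqP; rewrite mulf_eq0 subr_eq0.
    by rewrite [b == a]eq_sym (negPf ab) orbF => /eqP.
  apply/negP; rewrite -leqNgt (leq_trans (size_polyD _ _)) // geq_max.
  rewrite -ltnS (leq_trans pq) //= size_polyN.
  apply: (big_ind (fun g : {poly F} => (size g <= size s)%N))
    => [|g h gs hs|a _].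
  - by rewrite size_poly0.
  - by rewrite (leq_trans (size_polyD _ _)) // geq_max gs.
  - rewrite (leq_trans (size_scale_leq _ _)) // size_divp ?polyXsubC_eq0 //.
    by rewrite size_XsubC leq_subLR add1n.
rewrite {1}pE horner_sum big_distrl /=; apply: eq_big_seq => a as_.
have qxE : q.[x] = (q %/ ('X - a%:P)).[x] * (x - a).
  by rewrite {1}(qE a as_) !hornerE.
move: qx; rewrite hornerZ qxE mulf_eq0 negb_or => /andP[qx0 xa].
by rewrite invfM mulrA mulfK.
Qed.

(** * Geometric decay and total probability *)

Lemma cvg_complex_expr (R : realType) (z : R[i]) :
  `|z| < 1 -> (fun n => z ^+ n : R[i]^o) @ \oo --> (0 : R[i]^o).
Proof.
(* Moduli in [R[i]] are elements of [R[i]]; passing to their real parts reduces the claim to the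
   real geometric sequence. *)
move=> z1; have zE : `|z| = (complex.Re `|z|)%:C by rewrite RRe_real ?normr_real.
have r0 : 0 <= complex.Re `|z| by rewrite -lecR -zE; exact: normr_ge0.
have r1 : `|complex.Re `|z| | < 1 by rewrite ger0_norm // -ltcR -zE.
apply/cvgrPdist_lt => e e0.
have eE : e = (complex.Re e)%:C by rewrite RRe_real // gtr0_real.
have re0 : 0 < complex.Re e by rewrite -ltcR -eE.
have /cvgrPdist_lt/(_ _ re0) := cvg_expr r1.
apply: filterS => n; rewrite !sub0r !normrN => H.
rewrite [ltLHS]normrX zE eE -rmorphXn ltcR.
by rewrite -(ger0_norm (exprn_ge0 n r0)).
Qed.

(** Distinct states contribute a finite subsum of the total mass 1; this is what bounds the
    generating function on the disc. *)
Lemma sum_steady_state_le1 (R : realType) (Q : bulk_queue R)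
    (pi : epoch_state -> R) (e : nat -> epoch_state) (N : nat) :
  steady_state Q pi -> injective e -> \sum_(n < N) pi (e n) <= 1.
Proof.
move=> [pi0 pi1 _] einj; rewrite -lee_fin -pi1 -sumEFin.
apply: esum_ge; exists [set` [fset e (val i) | i in 'I_N]%fset].
  by split => //; exact: finite_fset.
rewrite fsbig_finite//= set_fsetK big_imfset/=; last first.
  by move=> i j _ _ /einj/val_inj.
by rewrite big_enum.
Qed.

(** * Coefficients of a rational generating function *)

Section ProbabilityGeneratingFunction.
Variables (R : realType) (f : nat -> R) (P D : {poly R[i]}).
Hypothesis f0 : forall n, 0 <= f n.
Hypothesis fsum : forall N, \sum_(n < N) f n <= 1.
Hypothesis D0 : D != 0.
Hypothesis hgf : forall x : R[i], `|x| <= 1 -> D.[x] != 0 ->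
  series (gf_term f x) @ \oo --> (P.[x] / D.[x] : R[i]^o).

Let norm_f n : `|(f n)%:C| = (f n)%:C :> R[i].
Proof. by rewrite ger0_norm // lecR. Qed.

Lemma gf_numerator_le (x : R[i]) : `|x| <= 1 -> D.[x] != 0 ->
  `|P.[x]| <= `|D.[x]|.
Proof.
move=> x1 Dx.
suff : `|P.[x] / D.[x]| <= 1.
  by rewrite normrM normfV ler_pdivrMr ?normr_gt0 // mul1r.
rewrite real_leNgt ?normr_real ?real1 //; apply/negP => lt1.
have [N _ /(_ N (leqnn N))] := cvgr_norm_gt _ (hgf x1 Dx) _ lt1.
apply/negP; rewrite -real_leNgt ?normr_real ?real1 //.
rewrite seriesEord /= (le_trans (ler_norm_sum _ _ _)) //.
apply: (@le_trans _ _ (\sum_(n < N) f n)%:C); last by rewrite lecR.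
rewrite rmorph_sum /=; apply: ler_sum => n _.
by rewrite normrM norm_f normrX ler_piMr ?exprn_ile1 // lecR.
Qed.

(** The bound by [|D|] is available only off the zeros of [D], so it is carried to [y] from nearby
    points [x] of the disc: [|P.[y]| <= (A + B) * |x - y|], which is too small once [x] is close to
    [y]. *)
Lemma gf_numerator_root (y : R[i]) : `|y| <= 1 -> root D y -> root P y.
Proof.
move=> y1 Dy; apply/negPn/negP => Py.
have [A A0 HA] := poly_lipschitz P y; have [B B0 HB] := poly_lipschitz D y.
have P0 : 0 < `|P.[y]| by rewrite normr_gt0.
have AB : 0 < A + B + 1 by rewrite ltr_wpDl ?addr_ge0.
have [x [x1 /andP[_ xy] Dx]] := nonroot_near D0 y1 (divr_gt0 P0 AB).
move: xy; rewrite ltr_pdivlMr // => /lt_geF/negP; apply.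
have Dle : `|D.[x]| <= B * `|x - y|.
  by have := HB x x1; rewrite (rootP Dy) subr0.
rewrite -[P.[y]](subKr P.[x]) (le_trans (ler_normB _ _)) //.
rewrite (le_trans (lerD (le_trans (gf_numerator_le x1 Dx) Dle) (HA x x1))) //.
by rewrite -mulrDl mulrC ler_wpM2l // [B + A]addrC lerDl.
Qed.

(** The size condition makes [s ++ t] a full list of the zeros of [D]. The minus sign comes from
    expanding [1 / (x - a)] as [- \sum_n x ^+ n / a ^+ n.+1]. *)
Lemma gf_coef (s : seq R[i]) (t : seq R[i]) :
  uniq (s ++ t) -> (size D <= (size (s ++ t)).+1)%N ->
  {in s ++ t, forall a, mup a D = 1%N} ->
  {in s, forall a, `|a| <= 1} -> {in t, forall a, 1 < `|a|} ->
  forall n, (f n)%:C =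
    (P %/ D)`_n + \sum_(a <- t) - (P.[a] / D^`().[a]) / a ^+ n.+1.
Proof.
move=> u sD simple hs ht n.
pose c a := P.[a] / D^`().[a].
pose h n := (P %/ D)`_n + \sum_(a <- t) - c a / a ^+ n.+1.
have Droot a : a \in s ++ t -> root D a.
  by move=> /simple sa; rewrite -dvdp_XsubCl XsubC_dvd // sa.
have PE x : P.[x] = (P %/ D).[x] * D.[x] + (P %% D).[x].
  by rewrite {1}(divp_eq P D) hornerD hornerM.
have rE x : root D x -> (P %% D).[x] = P.[x].
  by move=> /rootP Dx; rewrite [RHS]PE Dx mulr0 add0r.
(* The remainder agrees with [P] at the zeros of [D], so it may be replaced by [P] in the residues;
   those at [s] vanish with [P]. *)
have gfE x : D.[x] != 0 ->
    P.[x] / D.[x] = (P %/ D).[x] + \sum_(a <- t) c a / (x - a).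
  move=> Dx; rewrite PE mulrDl mulfK //; congr (_ + _).
  rewrite (partial_fractions D0 sD _ u simple Dx) ?ltn_modp //.
  rewrite big_cat /= big1_seq ?add0r.
    by apply: eq_big_seq => a ta; rewrite rE // Droot // mem_cat ta orbT.
  move=> a /andP[_ sa]; have Da : root D a by rewrite Droot // mem_cat sa.
  by rewrite rE // (rootP (gf_numerator_root (hs a sa) Da)) !mul0r.
apply/eqP; rewrite -subr_eq0; apply/eqP.
pose d n := (f n)%:C - h n; rewrite -/(d n).
(* The three summands bound [f n], the coefficient of the quotient, and the sum over [t], where
   [1 < |a|]. *)
apply: (@bounded_coef_identity _ d
  (1 + (\sum_(i < size (P %/ D)) `|(P %/ D)`_i| + \sum_(a <- t) `|c a|))).
  move=> {}n; rewrite (le_trans (ler_normB _ _)) // lerD //.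
    rewrite norm_f lecR (le_trans _ (fsum n.+1)) // big_ord_recr /= lerDr.
    by rewrite sumr_ge0.
  rewrite (le_trans (ler_normD _ _)) // lerD //.
    have [nP|nP] := ltnP n (size (P %/ D)).
      by rewrite (bigD1 (Ordinal nP)) //= lerDl sumr_ge0.
    by rewrite nth_default // normr0 sumr_ge0.
  rewrite (le_trans (ler_norm_sum _ _ _)) // big_seq [X in _ <= X]big_seq.
  apply: ler_sum => a ta; rewrite normrM normrN normfV normrX.
  rewrite ler_piMr // invf_le1 ?exprn_ege1 ?exprn_gt0 ?(lt_trans _ (ht a ta)) //.
  by rewrite ltW ?ht.
move=> e e0.
(* The radius [e / (1 + e)] is below both [e] and 1. *)
have [||x [_ /andP[x0 xe] Dx]] := @nonroot_near _ D 0 (e / (1 + e)) D0.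
- by rewrite normr0.
- by rewrite divr_gt0 // addr_gt0.
rewrite subr0 in x0 xe.
have e1 : 0 < 1 + e by rewrite addr_gt0.
have x1 : `|x| < 1.
  by rewrite (lt_le_trans xe) // ler_pdivrMr // mul1r lerDr.
exists x.
  rewrite x0 (lt_le_trans xe) // ler_pdivrMr // mulrDr mulr1 lerDl.
  by rewrite mulr_ge0 // ltW.
have xt a : a \in t -> a - x != 0.
  move=> /ht at1; rewrite subr_eq0; apply: contraTneq x1 => <-.
  by rewrite lt_gtF.
have a0 a : a \in t -> a != 0.
  by move=> /ht at1; rewrite -normr_gt0 (lt_trans _ at1).
have geo a N : a \in t ->
    \sum_(i < N) a ^- i.+1 * x ^+ i = (1 - (x / a) ^+ N) / (a - x).
  move=> ta; elim: N => [|N IHN]; first by rewrite big_ord0 expr0 subrr mul0r.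
  rewrite big_ord_recr /= IHN !expr_div_n !exprS.
  have aN : a ^+ N != 0 by rewrite expf_neq0 ?a0.
  by field; rewrite aN (a0 _ ta) (xt _ ta).
(* Once [N] reaches the size of the quotient, its truncation is the whole polynomial, and only the
   remainders of the geometric series separate the partial sum of [d] from [series (gf_term f x) N -
   P.[x] / D.[x]]. *)
have dS N : (size (P %/ D)%R <= N)%N -> \sum_(i < N) d i * x ^+ i =
    series (gf_term f x) N - (P.[x] / D.[x] +
      \sum_(a <- t) c a / (a - x) * (x / a) ^+ N).
  move=> sN; under eq_bigr do rewrite mulrBl.
  rewrite sumrB seriesEord; congr (_ - _).
  under eq_bigr do rewrite mulrDl mulr_suml.
  rewrite big_split /= -(horner_coef_wide _ sN) gfE // -addrA; congr (_ + _).
  rewrite exchange_big -big_split /=; apply: eq_big_seq => a ta.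
  under eq_bigr do rewrite -mulrA.
  rewrite -mulr_sumr geo // -(opprB a x) invrN.
  ring.
pose g N : R[i]^o := \sum_(a <- t) c a / (a - x) * (x / a) ^+ N.
(* Each ratio satisfies [|x / a| < 1] because [|x| < 1 < |a|]. *)
have cg : g @ \oo --> (0 : R[i]^o).
  have -> : (0 : R[i]^o) = \sum_(a <- t | a \in t) c a / (a - x) * 0.
    by rewrite big1 // => a _; rewrite mulr0.
  under [g]eq_fun do rewrite big_seq.
  apply: cvg_big => [|a ta]; first exact: add_continuous.
  apply: (@cvgMl_tmp _ _ \oo _ (fun N => (x / a) ^+ N : R[i]^o)).
  apply: cvg_complex_expr; rewrite normrM normfV ltr_pdivrMr ?normr_gt0 ?a0 //.
  by rewrite mul1r (lt_trans x1) ?ht.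
have cv := cvgB (hgf (ltW x1) Dx) (cvgD (cvg_cst (P.[x] / D.[x] : R[i]^o)) cg).
rewrite addr0 subrr in cv.
move=> r r0.
have r0' : `|0 : R[i]^o| < r by rewrite normr0.
have [N _ HN] := cvgr_norm_lt _ (cv _ _ _) _ r0'.
exists (maxn N (size (P %/ D)%R)) => k; rewrite geq_max => /andP[Nk Pk].
by rewrite dS //; exact: HN.
Qed.

End ProbabilityGeneratingFunction.

(** * Application to the queue *)

Theorem mainTheorem4 (R : realType) (Q : bulk_queue R)
    (pi : epoch_state -> R) (hpi : steady_state Q pi)
    (Lambda D : {poly R[i]}) (L1 M1 : nat)
    (degLambda : size Lambda = L1.+1) (degD : size D = M1.+1)
    (hgf : forall x : R[i], `|x| <= 1 -> D.[x] != 0 ->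
       series (gf_term (fun n => pi (n, Some (maxb Q))) x) @ \oo -->
         (Lambda.[x] / D.[x] : R[i]^o))
    (hD : exists2 q : {poly R[i]}, q != 0 &
       forall x : R[i], `|x| <= 1 -> D.[x] = q.[x] * (x ^+ maxb Q - Kb Q x))
    (beta : (maxb Q).-tuple R[i])
    (hbeta : simple_zeros D [pred x : R[i] | `|x| <= 1] beta)
    (alpha : (M1 - maxb Q).-tuple R[i])
    (halpha : simple_zeros D [pred x : R[i] | 1 < `|x|] alpha) :
  let p n : R[i] := (pi (n, Some (maxb Q)))%:C in
  let a (k : 'I_(M1 - maxb Q)) : R[i] := tnth alpha k in
  let c (k : 'I_(M1 - maxb Q)) : R[i] := - (Lambda.[a k] / D^`().[a k]) in
  ((M1 <= L1)%N ->
     forall tau : nat -> R[i],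
     Lambda %/ D = \poly_(i < (L1 - M1).+1) tau i ->
     (forall n, (n <= L1 - M1)%N -> p n = tau n + \sum_k c k / a k ^+ n.+1) /\
     (forall n, (L1 - M1 < n)%N -> p n = \sum_k c k / a k ^+ n.+1)) /\
  ((L1 < M1)%N -> forall n, p n = \sum_k c k / a k ^+ n.+1).

Proof.
move=> p a c.
have D0 : D != 0 by rewrite -size_poly_gt0 degD.
have [ub hb mb] := hbeta; have [ua ha ma] := halpha.
(* One formula covers all cases; they differ only in the [n]-th coefficient of the quotient, which
   is 0 for [n > L1 - M1] and for every [n] if [L1 < M1]. *)
have coef n : p n = (Lambda %/ D)`_n + \sum_k c k / a k ^+ n.+1.
  rewrite /p (@gf_coef _ (fun n => pi (n, Some (maxb Q))) Lambda D _ _ D0 hgf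
    beta alpha) ?big_tuple //.
  - by have [pi0 _ _] := hpi.
  - move=> N; apply: (sum_steady_state_le1
      (e := fun n => (n, Some (maxb Q))) N hpi).
    by move=> i j [].
  - rewrite cat_uniq ub ua andbT /=; apply/hasPn => x; rewrite ha hb.
    by move=> /andP[_ x1]; rewrite negb_and /= lt_geF ?orbT.
  (* The two lists together have [maxb Q + (M1 - maxb Q)] entries, at least [M1] even with truncated
     subtraction. *)
  - by rewrite size_cat !size_tuple degD ltnS -leq_subLR.
  - by move=> x; rewrite mem_cat => /orP[/mb|/ma].
  - by move=> x; rewrite hb => /andP[].
  - by move=> x; rewrite ha => /andP[].
split=> [LM tau quoE|LM n].
  split=> n nLM; rewrite coef quoE coef_poly ltnS.
    by rewrite nLM.
  by rewrite leqNgt nLM add0r.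
by rewrite coef divp_small ?degLambda ?degD // coef0 add0r.
Qed.
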